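(* Let $X=\{x\in\mathbb{R}^n\mid G(x)\le 0\}$ for a continuously differentiable function $G\colon\mathbb{R}^n\to\mathbb{R}^q$. Let $(\bar x,\bar y,\bar z,\bar u)\in\mathbb{R}^n\times\mathbb{R}^m\times\mathbb{R}^m\times\mathbb{R}^p$ be a feasible point of the Mond--Weir dual reformulation (MWD), i.e., a point satisfying the constraint system $$G(x)\le 0,\quad g(x,y)\le 0,\quad -u\le 0,\quad f(x,y)-f(x,z)\le 0,\quad -u^\top g(x,z)\le 0,\quad \nabla_2L(x,z,u)=0.$$ Then MFCQ for this constraint system is violated at $(\bar x,\bar y,\bar z,\bar u)$.
   Context: Let $f\colon\mathbb{R}^n\times\mathbb{R}^m\to\mathbb{R}$ and $g\colon\mathbb{R}^n\times\mathbb{R}^m\to\mathbb{R}^p$ be twice continuously differentiable such that, for each $x\in X$, $f(x,\cdot),g_1(x,\cdot),\ldots,g_p(x,\cdot)$ are convex. Vector inequalities are componentwise. $L(x,y,u):=f(x,y)+u^\top g(x,y)$, and $\nabla_2L$ denotes the gradient of $L$ with respect to its second argument. (MWD): $\min_{x,y,z,u}\{F(x,y)\mid x\in X,\ g(x,y)\le 0,\ u\ge 0,\ f(x,y)\le f(x,z),\ u^\top g(x,z)\ge 0,\ \nabla_2L(x,z,u)=0\}$, with a continuously differentiable objective $F\colon\mathbb{R}^n\times\mathbb{R}^m\to\mathbb{R}$ (which plays no role for the constraint qualification). MFCQ: for a system $q_i(w)\le 0$ ($i=1,\ldots,\nu$), $q_i(w)=0$ ($i=\nu+1,\ldots,t$)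 with continuously differentiable $q_i\colon\mathbb{R}^s\to\mathbb{R}$, MFCQ holds at a feasible point $\bar w$ if the conditions $\sum_{i=1}^t v_i\nabla q_i(\bar w)=0$ and $v_i\ge 0$, $v_i\,q_i(\bar w)=0$ for $i=1,\ldots,\nu$ possess only the trivial solution $v_1=\dots=v_t=0$; it is violated at $\bar w$ otherwise. *)

(* Defs.v *)
From HB Require Import structures.
From mathcomp Require Import all_boot all_order all_algebra.
From mathcomp Require Import all_classical all_reals all_analysis.

Set Implicit Arguments.
Unset Strict Implicit.
Unset Printing Implicit Defensive.

Import Order.TTheory GRing.Theory Num.Theory.
Import numFieldNormedType.Exports.

Local Open Scope classical_set_scope.
Local Open Scope ring_scope.

(* R^k is 'rV[R]_k; points of a product space are concatenated with row_mx. *)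

Definition dot (R : realType) (k : nat) (u v : 'rV[R]_k) : R :=
  \sum_(i < k) u 0 i * v 0 i.

(* Meaningful only where h is differentiable, since 'D_v is a total operator. *)
Definition grad (R : realType) (k : nat) (h : 'rV[R]_k -> R) (w : 'rV[R]_k) :
    'rV[R]_k :=
  \row_(j < k) 'D_(delta_mx 0 j) h w.

Definition C1 (R : realType) (k : nat) (h : 'rV[R]_k -> R) : Prop :=
  (forall w, differentiable h w) /\ continuous (grad h).

Definition C2 (R : realType) (k : nat) (h : 'rV[R]_k -> R) : Prop :=
  C1 h /\ forall j : 'I_k, C1 (fun w => grad h w 0 j).

Definition joint (R : realType) (n m : nat) (T : Type)
    (h : 'rV[R]_n -> 'rV[R]_m -> T) (w : 'rV[R]_(n + m)) : T :=
  h (lsubmx w) (rsubmx w).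

Definition nonpos (R : realType) (k : nat) (v : 'rV[R]_k) : Prop :=
  forall i : 'I_k, v 0 i <= 0.

Section ConstraintSystem.
Variables (R : realType) (s nu mu : nat).

(* The system qI w <= 0, qE w = 0; the components of qI are
   q_1, ..., q_nu and those of qE are q_(nu+1), ..., q_t with t = nu + mu. *)
Variables (qI : 'rV[R]_s -> 'rV[R]_nu) (qE : 'rV[R]_s -> 'rV[R]_mu).

Definition feasible (w : 'rV[R]_s) : Prop := nonpos (qI w) /\ qE w = 0.

(* To be used at feasible points w only. *)
Definition MFCQ (w : 'rV[R]_s) : Prop :=
  forall (a : 'rV[R]_nu) (b : 'rV[R]_mu),
    \sum_(i < nu) a 0 i *: grad (fun w' => qI w' 0 i) w
      + \sum_(i < mu) b 0 i *: grad (fun w' => qE w' 0 i) w = 0 ->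
    (forall i : 'I_nu, 0 <= a 0 i) ->
    (forall i : 'I_nu, a 0 i * qI w 0 i = 0) ->
    a = 0 /\ b = 0.

End ConstraintSystem.

Section MondWeir.
Variables (R : realType) (n m p q : nat).
Variables (f : 'rV[R]_n -> 'rV[R]_m -> R) (g : 'rV[R]_n -> 'rV[R]_m -> 'rV[R]_p)
  (G : 'rV[R]_n -> 'rV[R]_q).

Definition Lagrangian (x : 'rV[R]_n) (y : 'rV[R]_m) (u : 'rV[R]_p) : R :=
  f x y + dot u (g x y).

Definition grad2_Lagrangian (x : 'rV[R]_n) (y : 'rV[R]_m) (u : 'rV[R]_p) :
    'rV[R]_m :=
  grad (fun y' => Lagrangian x y' u) y.

Definition MWD_point (x : 'rV[R]_n) (y z : 'rV[R]_m) (u : 'rV[R]_p) :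
    'rV[R]_(n + (m + (m + p))) :=
  row_mx x (row_mx y (row_mx z u)).

Definition xpart (w : 'rV[R]_(n + (m + (m + p)))) : 'rV[R]_n := lsubmx w.
Definition ypart (w : 'rV[R]_(n + (m + (m + p)))) : 'rV[R]_m :=
  lsubmx (rsubmx w).
Definition zpart (w : 'rV[R]_(n + (m + (m + p)))) : 'rV[R]_m :=
  lsubmx (rsubmx (rsubmx w)).
Definition upart (w : 'rV[R]_(n + (m + (m + p)))) : 'rV[R]_p :=
  rsubmx (rsubmx (rsubmx w)).

Definition MWD_ineq (w : 'rV[R]_(n + (m + (m + p)))) :
    'rV[R]_(q + (p + (p + (1 + 1)))) :=
  let x := xpart w in let y := ypart w in
  let z := zpart w in let u := upart w in
  row_mx (G x)
 (row_mx (g x y)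
 (row_mx (- u)
 (row_mx (const_mx (f x y - f x z))
         (const_mx (- dot u (g x z)))))).

Definition MWD_eq (w : 'rV[R]_(n + (m + (m + p)))) : 'rV[R]_m :=
  grad2_Lagrangian (xpart w) (zpart w) (upart w).

Lemma nonpos_row_mx (k l : nat) (v : 'rV[R]_k) (v' : 'rV[R]_l) :
  nonpos (row_mx v v') <-> nonpos v /\ nonpos v'.
Proof.
split=> [h|[h h'] i].
  split=> i; first by have := h (lshift l i); rewrite row_mxEl.
  by have := h (rshift k i); rewrite row_mxEr.
by case: (fintype.split_ordP i) => j ->; rewrite ?row_mxEl ?row_mxEr.
Qed.

Lemma nonpos_const (c : R) : nonpos (const_mx c : 'rV[R]_1) <-> c <= 0.
Proof. by split=> [/(_ 0)|h i]; rewrite mxE. Qed.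

Lemma MWD_feasibleP (x : 'rV[R]_n) (y z : 'rV[R]_m) (u : 'rV[R]_p) :
  feasible MWD_ineq MWD_eq (MWD_point x y z u) <->
  [/\ nonpos (G x), nonpos (g x y), (forall i, 0 <= u 0 i), f x y <= f x z
    & 0 <= dot u (g x z) /\ grad2_Lagrangian x z u = 0].
Proof.
rewrite /feasible /MWD_ineq /MWD_eq /MWD_point /xpart /ypart /zpart /upart.
rewrite !(row_mxKl, row_mxKr) /=.
rewrite !nonpos_row_mx !nonpos_const subr_le0 oppr_le0.
suff -> : nonpos (- u) <-> forall i, 0 <= u 0 i by split=> [[[? [? [? []]]]]|[]] // *; intuition.
by split=> h i; have := h i; rewrite mxE oppr_le0.
Qed.

End MondWeir.

(* Main.v *)
Require Import Defs.
From HB Require Import structures.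
From mathcomp Require Import all_boot all_order all_algebra.
From mathcomp Require Import all_classical all_reals all_analysis.
From mathcomp Require Import ring lra.

Set Implicit Arguments.
Unset Strict Implicit.
Unset Printing Implicit Defensive.

Import Order.TTheory GRing.Theory Num.Theory.
Import numFieldNormedType.Exports.

Local Open Scope classical_set_scope.
Local Open Scope ring_scope.


(** For x in X and u >= 0 the convexity of L(x, ., u) says that
<<
  gap (x, y, z, u)
    = L (x, y, u) - L (x, z, u) - <grad_2 L (x, z, u), y - z>  >=  0,
>>
    which is weak duality for the Mond-Weir dual.  At a feasible point the
    constraints make every term of the gap nonpositive, so the gap vanishes:
    a feasible point minimizes the gap subject to G (x) <= 0 and u >= 0.  The
    Fritz John theorem ([fritz_john]) then gives nonnegative multipliers
    (mu, l, nu), not all zero, with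
<<
  mu * grad gap + sum_i l_i * grad G_i + sum_i nu_i * grad (- u_i) = 0.
>>
    On the other hand, the gap is built from the constraint functions:
<<
  gap = (f (x, y) - f (x, z)) - u^T g (x, z)
        + u^T g (x, y) + <grad_2 L (x, z, u), z - y>,
>>
    so, by the product rule and since grad_2 L vanishes at the point, grad gap
    is a combination of the gradients of the constraints themselves
    ([grad_gap]): coefficient 1 on the two scalar constraints, u on
    g (x, y) <= 0, - g (x, y) >= 0 on - u <= 0, and z - y on the equations.
    Substituting this into the Fritz John identity produces multipliers that
    violate MFCQ.  The signs are right, complementarity holds because all the
    terms of the gap vanish separately, and the family is nonzero: either
    mu > 0, and mu is the multiplier of f (x, y) - f (x, z) <= 0, or mu = 0
    and (l, nu) is left unchanged.

    The Fritz John theorem is derived from Gordan's theorem of the alternative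
    ([gordan]). *)

(** * The Euclidean inner product *)

Section Dot.
Variables (R : realType) (k : nat).
Implicit Types u v w : 'rV[R]_k.

Lemma dotC u v : dot u v = dot v u.
Proof. by apply: eq_bigr => i _; rewrite mulrC. Qed.

Lemma dotDr u v w : dot u (v + w) = dot u v + dot u w.
Proof. by rewrite -big_split; apply: eq_bigr => i _; rewrite mxE mulrDr. Qed.

Lemma dotZr a u v : dot u (a *: v) = a * dot u v.
Proof. by rewrite mulr_sumr; apply: eq_bigr => i _; rewrite mxE mulrCA. Qed.

Lemma dotNr u v : dot u (- v) = - dot u v.
Proof. by rewrite -scaleN1r dotZr mulN1r. Qed.

Lemma dot_gt0 u : u != 0 -> 0 < dot u u.
Proof.
move=> u0; rewrite lt_neqAle sumr_ge0 ?andbT; last first.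
  by move=> i _; rewrite -expr2 sqr_ge0.
apply: contra u0; rewrite eq_sym psumr_eq0 => [/allP h|i _]; last first.
  by rewrite -expr2 sqr_ge0.
apply/eqP/rowP => i; rewrite mxE; apply/eqP; rewrite -sqrf_eq0 expr2.
exact: (h i (mem_index_enum i)).
Qed.

End Dot.

(** * Gordan's theorem of the alternative *)

(** The conclusion covers a whole interval of steps t, since the induction
    shrinks the step when an element is added to the list. *)
Lemma small_perturbation (R : realType) (I : eqType) (c v : I -> R)
    (s : seq I) :
  (forall i, i \in s -> c i < 0) ->
  exists2 e, 0 < e &
    forall t, 0 < t <= e -> forall i, i \in s -> c i + t * v i < 0.
Proof.
elim: s => [_|a s ih c0]; first by exists 1.
have [|e e0 he] := ih; first by move=> i si; apply: c0; rewrite inE si orbT.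
have v1 : 0 < 1 + `|v a| by rewrite ltr_wpDr.
exists (Num.min e (- c a / (1 + `|v a|))).
  by rewrite lt_min e0 divr_gt0// oppr_gt0 c0 ?mem_head.
move=> t /andP[t0]; rewrite le_min => /andP[te].
rewrite ler_pdivlMr// => tc i; rewrite inE => /orP[/eqP ->|]; last first.
  by apply: he; rewrite t0.
rewrite -ltrBrDl sub0r (lt_le_trans _ tc)// ltr_pM2l//.
by rewrite (le_lt_trans (ler_norm _))// ltrDr.
Qed.

(** Induction on the list.  If d is strictly decreasing for the tail but not
    for the head A a, the vectors (A a . d) A_i - (A_i . d) A a are
    nonnegative combinations of A a and A_i, orthogonal to d.  A vanishing
    combination of them is one of the A_i with a positive coefficient on A a;
    a decrease direction e for them yields, after adding a multiple of d to it,
    a direction orthogonal to A a and still strictly decreasing for the tail,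
    which a small step along - A a, for A a != 0, makes strictly decreasing
    for A a too. *)
Lemma gordan (R : realType) (k : nat) (I : eqType) (s : seq I)
    (A : I -> 'rV[R]_k) : uniq s ->
  (exists d, forall i, i \in s -> dot (A i) d < 0) \/
  exists l : I -> R, [/\ forall i, 0 <= l i, exists2 i, i \in s & 0 < l i
    & \sum_(i <- s) l i *: A i = 0].
Proof.
elim: s A => [A _|a s ih A /=/andP[nas us]]; first by left; exists 0.
have neqa i : i \in s -> (i == a) = false.
  by move=> si; apply/eqP => ia; rewrite -ia si in nas.
have [[d dP]|[l [l0 [j js lj] sl]]] := ih A us; last first.
  right; exists (fun i => if i == a then 0 else l i); split.
  - by move=> i; case: ifP.
  - by exists j; rewrite ?inE ?js ?orbT// neqa.
  - rewrite big_cons eqxx scale0r add0r -[RHS]sl.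
    by apply: eq_big_seq => i /neqa ->.
have [da|da] := ltP (dot (A a) d) 0.
  by left; exists d => i; rewrite inE => /orP[/eqP ->|/dP].
have [Aa|Aa] := eqVneq (A a) 0.
  right; exists (fun i => (i == a)%:R); split => [i||].
  - by rewrite ler0n.
  - by exists a; rewrite ?mem_head ?eqxx.
  - rewrite big_cons Aa scaler0 add0r big1_seq// => i /andP[_ /neqa ->].
    by rewrite scale0r.
set al := dot (A a) d in da.
have [[e eP]|[l [l0 [j js lj] sl]]] :=
    ih (fun i => al *: A i - dot (A i) d *: A a) us.
  left; pose d' := al *: e - dot (A a) e *: d.
  have d's i : i \in s -> dot (A i) d' < 0.
    move=> /eP; rewrite /d' dotC dotDr dotNr !dotZr (dotC e) (dotC e (A a)).
    by rewrite dotDr dotNr !dotZr (mulrC (dot (A i) d)).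
  have d'a : dot (A a) d' = 0.
    by rewrite /d' dotDr dotNr !dotZr -/al mulrC subrr.
  have [r r0 hr] := small_perturbation (fun i => dot (A i) (- A a)) d's.
  exists (d' + r *: - A a) => i; rewrite inE dotDr dotZr => /orP[/eqP ->|].
    by rewrite d'a add0r dotNr mulrN oppr_lt0 mulr_gt0// dot_gt0.
  by apply: hr; rewrite r0 lexx.
(* The coefficient that A a receives when the combination l is expanded. *)
pose la := \sum_(i <- s) l i * - dot (A i) d.
have la0 : 0 < la.
  rewrite /la (bigD1_seq j)//= ltr_wpDr//.
    rewrite big_seq_cond sumr_ge0// => i /andP[si _].
    by rewrite mulr_ge0// oppr_ge0 ltW// dP.
  by rewrite mulr_gt0// oppr_gt0 dP.
right; exists (fun i => if i == a then la else al * l i); split.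
- by move=> i; case: ifP => _; [exact: ltW|rewrite mulr_ge0].
- by exists a; rewrite ?mem_head ?eqxx.
- rewrite big_cons eqxx /la scaler_suml -big_split/= -[RHS]sl.
  apply: eq_big_seq => i /neqa ->.
  by rewrite scalerBr !scalerA mulrN scaleNr addrC (mulrC al).
Qed.

(** * Gradients and first-order conditions *)

Section Gradient.
Variables (R : realType) (k : nat).
Implicit Types (h : 'rV[R]_k -> R) (w d : 'rV[R]_k).

Lemma derive_grad h w d : differentiable h w -> 'D_d h w = dot (grad h w) d.
Proof.
move=> dh; rewrite deriveE// [in LHS](row_sum_delta d) linear_sum.
by apply: eq_bigr => i _; rewrite linearZ mxE -deriveE// mulrC.
Qed.

Lemma gradD h1 h2 w : differentiable h1 w -> differentiable h2 w ->
  grad (fun w => h1 w + h2 w) w = grad h1 w + grad h2 w.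
Proof.
move=> d1 d2; apply/rowP => j; rewrite !mxE.
by apply: deriveD; exact: diff_derivable.
Qed.

Lemma gradN h w : differentiable h w ->
  grad (fun w => - h w) w = - grad h w.
Proof.
move=> dh; apply/rowP => j; rewrite !mxE.
by apply: deriveN; exact: diff_derivable.
Qed.

Lemma gradM h1 h2 w : differentiable h1 w -> differentiable h2 w ->
  grad (fun w => h1 w * h2 w) w = h1 w *: grad h2 w + h2 w *: grad h1 w.
Proof.
move=> d1 d2; apply/rowP => j; rewrite !mxE.
by apply: deriveM; exact: diff_derivable.
Qed.

Lemma differentiable_sumf n (h : 'I_n -> 'rV[R]_k -> R) w :
  (forall i, differentiable (h i) w) ->
  differentiable (fun w => \sum_(i < n) h i w) w.
Proof.
by move=> dh; rewrite -fct_sumE; exact: differentiable_sum.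
Qed.

Lemma grad_sum n (h : 'I_n -> 'rV[R]_k -> R) w :
  (forall i, differentiable (h i) w) ->
  grad (fun w => \sum_(i < n) h i w) w = \sum_(i < n) grad (h i) w.
Proof.
move=> dh; apply/rowP => j; rewrite summxE mxE -fct_sumE derive_sum.
  by apply: eq_bigr => i _; rewrite mxE.
by move=> i; exact: diff_derivable.
Qed.

Lemma cvg_right_derive h w d : differentiable h w ->
  t^-1 * (h (t *: d + w) - h w) @[t --> 0^'+] --> 'D_d h w.
Proof.
move=> dh; apply: cvg_dnbhs_at_right.
have : derivable h w d by exact: diff_derivable.
exact.
Qed.

(** A direction only has to decrease the constraints active at [w]: continuity
    takes care of the inactive ones. *)
Lemma near_lt0 h w d : differentiable h w -> h w <= 0 ->
  (h w = 0 -> dot (grad h w) d < 0) ->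
  \forall t \near (0 : R)^'+, h (t *: d + w) < 0.
Proof.
move=> dh hw hd; case: (ltgtP (h w) 0) hw => // [hw _|hw _].
  have ch : {for 0, continuous (fun t : R => h (t *: d + w))}.
    apply: continuous_comp.
      apply: continuousD; last exact: cst_continuous.
      exact: scalel_continuous.
    by rewrite scale0r add0r; exact: differentiable_continuous.
  apply: (cvgr_lt (h (0 *: d + w))); first exact: cvg_at_right_filter.
  by rewrite scale0r add0r.
have Dlt : 'D_d h w < 0 by rewrite derive_grad// hd.
near=> t.
have t0 : 0 < t by near: t; exact: nbhs_right_gt.
have : t^-1 * (h (t *: d + w) - h w) < 0.
  by near: t; exact: (cvgr_lt _ (cvg_right_derive dh) _ Dlt).
by rewrite hw subr0 pmulr_rlt0// invr_gt0.
Unshelve. all: by end_near. Qed.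


(** No point can make E - E w and all the active constraints negative at once,
    so by linearization there is no direction strictly decreasing all of them,
    and Gordan's theorem applied to their gradients gives the multipliers. *)
Lemma fritz_john (I : finType) (E : 'rV[R]_k -> R) (c : I -> 'rV[R]_k -> R) w :
  differentiable E w -> (forall i, differentiable (c i) w) ->
  (forall i, c i w <= 0) ->
  (forall w', (forall i, c i w' <= 0) -> E w <= E w') ->
  exists mu : R, exists l : I -> R,
    [/\ 0 <= mu /\ (forall i, 0 <= l i),
        0 < mu \/ (exists i, 0 < l i),
        forall i, l i * c i w = 0
      & mu *: grad E w + \sum_i l i *: grad (c i) w = 0].
Proof.
move=> dE dc cw optE.
(* The index [None] stands for the objective. *)
pose h (o : option I) : 'rV[R]_k -> R :=
  if o is Some i then c i else fun w' => E w' + - E w.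
have dh o : differentiable (h o) w.
  by case: o => [i|]; [exact: dc|apply: differentiableD].
have hE : h None w = 0 by rewrite /h subrr.
pose act := [pred o | h o w == 0].
have [[d dP]|[l [l0 [j js lj] sl]]] :=
  gordan (fun o => grad (h o) w) (enum_uniq act).
  have : \forall t \near (0 : R)^'+, forall o, h o (t *: d + w) < 0.
    apply: filter_forall => o; apply: near_lt0 => //.
      by case: o => [i|]; [exact: cw|rewrite hE].
    by move=> ho0; apply: dP; rewrite mem_enum inE ho0.
  move=> /filter_ex[t ht].
  have := ht None; rewrite /h subr_lt0 ltNge optE// => i.
  exact: ltW (ht (Some i)).
rewrite mem_enum in js.
pose l' o := if o \in act then l o else 0.
have l'0 o : 0 <= l' o by rewrite /l'; case: ifP.
exists (l' None), (fun i => l' (Some i)); split => //.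
- by case: j js lj => [i|] js lj; [right; exists i|left]; rewrite /l' js.
- move=> i; rewrite /l'; case: ifP => [/eqP ci|_]; last by rewrite mul0r.
  by rewrite [c i w]ci mulr0.
- have -> : grad E w = grad (h None) w.
    rewrite /h gradD// -[LHS]addr0; congr (_ + _).
    by apply/rowP => i; rewrite !mxE derive_cst.
  have -> : l' None *: grad (h None) w +
      \sum_i l' (Some i) *: grad (c i) w = \sum_o l' o *: grad (h o) w.
    rewrite [RHS](bigD1 None)//=; congr (_ + _).
    rewrite [RHS](reindex_omap Some id) => [|[]//].
    by apply: eq_bigl => i; rewrite eqxx.
  rewrite -[RHS]sl big_enum [RHS]big_mkcond/=; apply: eq_bigr => o _.
  by rewrite /l'; case: ifP => // _; rewrite scale0r.
Qed.

(** The difference quotients along [w' - w] are at most [h w' - h w] for steps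
    in ]0, 1], hence so is their limit. *)
Lemma convex_ge_tangent h w w' : convex_function setT h ->
  differentiable h w -> h w + dot (grad h w) (w' - w) <= h w'.
Proof.
move=> ch dh; rewrite -lerBrDl -derive_grad//.
apply: (cvgr_to_le (cvg_right_derive (d := w' - w) dh)).
near=> t.
have t0 : 0 < t by near: t; exact: nbhs_right_gt.
have t1 : t <= 1 by near: t; exact: nbhs_right_le.
rewrite ler_pdivrMl//.
have tE : t *: (w' - w) + w = t *: w' + (1 - t) *: w.
  by rewrite scalerBr scalerBl scale1r addrA addrAC.
have /(_ (in_setT _) (in_setT _)) := ch (Itv01 (ltW t0) t1) w' w.
rewrite [X in X <= _](_ : _ = h (t *: (w' - w) + w)); last by rewrite tE.
rewrite [X in _ <= X](_ : _ = t * h w' + (1 - t) * h w); last by [].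
by move=> hle; rewrite lerBlDr (le_trans hle)//; lra.
Unshelve. all: by end_near. Qed.

End Gradient.

(** * Block vectors and partial gradients *)

Section Blocks.
Variables (R : realType).

Lemma continuous_row_mx (k l : nat) :
  continuous (fun c : 'rV[R]_k * 'rV[R]_l => row_mx c.1 c.2).
Proof.
move=> c A /nbhs_ballP[e /= e0 eA].
apply/nbhs_ballP; exists e => //= c' [[_ cc1] [_ cc2]]; apply: eA.
split => // i j; case: (fintype.split_ordP j) => j' ->.
  by rewrite !row_mxEl; exact: cc1.
by rewrite !row_mxEr; exact: cc2.
Qed.

Lemma differentiable_row_mx (V : normedModType R) (k l : nat)
    (a : V -> 'rV[R]_k) (b : V -> 'rV[R]_l) (v : V) :
  differentiable a v -> differentiable b v ->
  differentiable (fun v => row_mx (a v) (b v)) v.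
Proof.
move=> da db.
have lin : linear (fun c : 'rV[R]_k * 'rV[R]_l => row_mx c.1 c.2).
  by move=> t c c'; rewrite scale_row_mx add_row_mx.
pose linM := GRing.isLinear.Build _ _ _ _ _ lin.
pose L : {linear _ -> _} :=
  HB.pack (fun c : 'rV[R]_k * 'rV[R]_l => row_mx c.1 c.2) linM.
apply: (differentiable_comp (f := fun v => (a v, b v)) (g := L)).
  exact: differentiable_pair.
apply: linear_differentiable; exact: continuous_row_mx.
Qed.

Variables (n m : nat).
Implicit Types (h : 'rV[R]_n -> 'rV[R]_m -> R) (x : 'rV[R]_n) (y : 'rV[R]_m).

Lemma differentiable_slice h x y :
  differentiable (joint h) (row_mx x y) -> differentiable (h x) y.
Proof.
move=> dh; have -> : h x = joint h \o (fun y => row_mx x y).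
  by apply/funext => y' /=; rewrite /joint row_mxKl row_mxKr.
apply: differentiable_comp => //.
by apply: differentiable_row_mx => //; exact: differentiable_cst.
Qed.

(** This reads the partial gradient as a block of the full one, which makes its
    dependence on both arguments differentiable for a C2 function. *)
Lemma grad_slice h x y j :
  grad (h x) y 0 j = grad (joint h) (row_mx x y) 0 (rshift n j).
Proof.
rewrite !mxE /derive.
have E t : joint h (t *: delta_mx 0 (rshift n j) + row_mx x y) =
    h x (t *: delta_mx 0 j + y).
  rewrite -[delta_mx 0 (rshift n j)]hsubmxK scale_row_mx add_row_mx.
  rewrite /joint row_mxKl row_mxKr; congr (h _ (_ *: _ + _)).
    by apply/rowP => i; rewrite !mxE eq_lrshift andbF mulr0 add0r.
  by apply/rowP => i; rewrite !mxE eq_rshift.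
have -> : (fun t : R => t^-1 *: ((joint h \o shift (row_mx x y))
      (t *: delta_mx 0 (rshift n j)) - joint h (row_mx x y))) =
    (fun t : R => t^-1 *: ((h x \o shift y) (t *: delta_mx 0 j) - h x y)).
  by apply/funext => t /=; rewrite E /joint row_mxKl row_mxKr.
by [].
Qed.

Lemma combine_row_mx (s k l : nat) (P : 'rV[R]_s -> 'rV[R]_k)
    (Q : 'rV[R]_s -> 'rV[R]_l) (a : 'rV[R]_k) (b : 'rV[R]_l) w :
  \sum_(i < k + l) row_mx a b 0 i *:
      grad (fun w => row_mx (P w) (Q w) 0 i) w =
  \sum_(i < k) a 0 i *: grad (fun w => P w 0 i) w +
  \sum_(i < l) b 0 i *: grad (fun w => Q w 0 i) w.
Proof.
rewrite big_split_ord; apply: (f_equal2 +%R); apply: eq_bigr => i _.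
  rewrite row_mxEl.
  have -> : (fun w => row_mx (P w) (Q w) 0 (lshift l i)) = (fun w => P w 0 i).
    by apply/funext => w'; rewrite row_mxEl.
  by [].
rewrite row_mxEr.
have -> : (fun w => row_mx (P w) (Q w) 0 (rshift k i)) = (fun w => Q w 0 i).
  by apply/funext => w'; rewrite row_mxEr.
by [].
Qed.

Lemma combine_const_mx (s : nat) (c : 'rV[R]_s -> R) (a : R) w :
  \sum_(i < 1) (const_mx a : 'rV[R]_1) 0 i *:
      grad (fun w => (const_mx (c w) : 'rV[R]_1) 0 i) w = a *: grad c w.
Proof.
rewrite big_ord1 mxE.
have -> : (fun w => (const_mx (c w) : 'rV[R]_1) 0 0) = c.
  by apply/funext => w'; rewrite mxE.
by [].
Qed.

(** Sign and complementarity of block multipliers are checked blockwise. *)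
Lemma row_mx_rel (P : R -> R -> Prop) (k l : nat) (a c : 'rV[R]_k)
    (b d : 'rV[R]_l) :
  (forall i, P (a 0 i) (c 0 i)) -> (forall i, P (b 0 i) (d 0 i)) ->
  forall i, P (row_mx a b 0 i) (row_mx c d 0 i).
Proof.
by move=> ac bd i; case: (fintype.split_ordP i) => j ->;
  rewrite ?row_mxEl ?row_mxEr.
Qed.

End Blocks.

(** * The weak duality gap *)

Section Gap.
Variables (R : realType) (n m p : nat).
Variables (f : 'rV[R]_n -> 'rV[R]_m -> R).
Variables (g : 'rV[R]_n -> 'rV[R]_m -> 'rV[R]_p).
Hypothesis hf : C2 (joint f).
Hypothesis hg : forall i : 'I_p, C2 (joint (fun x y => g x y 0 i)).

Notation point := 'rV[R]_(n + (m + (m + p))).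
Implicit Types (w : point).

(** The amount by which L(x, ., u) lies at y above its tangent at z. *)
Definition gap w : R :=
  let x := xpart w in let y := ypart w in
  let z := zpart w in let u := upart w in
  Lagrangian f g x y u - Lagrangian f g x z u
    - dot (grad2_Lagrangian f g x z u) (y - z).

Lemma differentiable_xpart w : differentiable (@xpart R n m p) w.
Proof. exact: differentiable_lsubmx. Qed.

Lemma differentiable_ypart w : differentiable (@ypart R n m p) w.
Proof.
apply: (differentiable_comp (f := rsubmx) (g := lsubmx)).
  exact: differentiable_rsubmx.
exact: differentiable_lsubmx.
Qed.

Lemma differentiable_zpart w : differentiable (@zpart R n m p) w.
Proof.
apply: (differentiable_comp (f := rsubmx \o rsubmx) (g := lsubmx)).
  by apply: differentiable_comp; exact: differentiable_rsubmx.
exact: differentiable_lsubmx.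
Qed.

Lemma differentiable_upart w : differentiable (@upart R n m p) w.
Proof.
apply: (differentiable_comp (f := rsubmx \o rsubmx) (g := rsubmx)).
  by apply: differentiable_comp; exact: differentiable_rsubmx.
exact: differentiable_rsubmx.
Qed.

Lemma differentiable_upart_coord w i :
  differentiable (fun w : point => upart w 0 i) w.
Proof.
apply: (differentiable_comp (f := @upart R n m p) (g := fun u => u 0 i)).
  exact: differentiable_upart.
exact: differentiable_coord.
Qed.

Lemma differentiable_at_xy (h : 'rV[R]_(n + m) -> R) w :
  (forall v, differentiable h v) ->
  differentiable (fun w => h (row_mx (xpart w) (ypart w))) w.
Proof.
move=> dh; apply: (differentiable_comp (g := h)) => //.
apply: differentiable_row_mx; first exact: differentiable_xpart.
exact: differentiable_ypart.
Qed.

Lemma differentiable_at_xz (h : 'rV[R]_(n + m) -> R) w :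
  (forall v, differentiable h v) ->
  differentiable (fun w => h (row_mx (xpart w) (zpart w))) w.
Proof.
move=> dh; apply: (differentiable_comp (g := h)) => //.
apply: differentiable_row_mx; first exact: differentiable_xpart.
exact: differentiable_zpart.
Qed.

Lemma jointE (h : 'rV[R]_n -> 'rV[R]_m -> R) x y :
  joint h (row_mx x y) = h x y.
Proof. by rewrite /joint row_mxKl row_mxKr. Qed.

Lemma differentiable_f2 x y : differentiable (f x) y.
Proof. by apply: differentiable_slice; case: hf => -[]. Qed.

Lemma differentiable_g2 i x y : differentiable (fun y => g x y 0 i) y.
Proof.
apply: (differentiable_slice (h := fun x y => g x y 0 i)).
by case: (hg i) => -[].
Qed.

Lemma grad2_LagrangianE x z u :
  grad2_Lagrangian f g x z u =
  grad (f x) z + \sum_(i < p) u 0 i *: grad (fun y => g x y 0 i) z.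
Proof.
have dc i : differentiable (fun y => u 0 i * g x y 0 i) z.
  by apply: differentiableM => //; exact: differentiable_g2.
rewrite /grad2_Lagrangian /Lagrangian gradD; last 2 first.
- exact: differentiable_f2.
- exact: differentiable_sumf.
rewrite grad_sum//; congr (_ + _); apply: eq_bigr => i _.
rewrite gradM//; last exact: differentiable_g2.
rewrite [X in _ + _ *: X](_ : _ = 0) ?scaler0 ?addr0//.
by apply/rowP => j; rewrite !mxE derive_cst.
Qed.

Lemma differentiable_stationarity w j :
  differentiable (fun w => MWD_eq f g w 0 j) w.
Proof.
rewrite /MWD_eq.
rewrite (_ : (fun w => _) = fun w =>
    grad (joint f) (row_mx (xpart w) (zpart w)) 0 (rshift n j) +
    \sum_(i < p) upart w 0 i *
      grad (joint (fun x y => g x y 0 i)) (row_mx (xpart w) (zpart w))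
        0 (rshift n j)); last first.
  apply/funext => w'; rewrite grad2_LagrangianE mxE grad_slice summxE.
  congr (_ + _); apply: eq_bigr => i _.
  by rewrite mxE (grad_slice (fun x y => g x y 0 i)).
apply: differentiableD.
  apply: (differentiable_at_xz (h := fun v => grad (joint f) v 0 (rshift n j))).
  by case: hf => _ /(_ (rshift n j))[].
apply: differentiable_sumf => i; apply: differentiableM.
  exact: differentiable_upart_coord.
apply: (differentiable_at_xz
  (h := fun v => grad (joint (fun x y => g x y 0 i)) v 0 (rshift n j))).
by case: (hg i) => _ /(_ (rshift n j))[].
Qed.

(** As L(x, ., u) is a nonnegative combination of f(x, .) and the g_i(x, .),
    its tangent inequality is the same combination of theirs. *)
Lemma gap_ge0 w : convex_function setT (f (xpart w)) ->
  (forall i : 'I_p, convex_function setT (fun y => g (xpart w) y 0 i)) ->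
  (forall i, 0 <= upart w 0 i) -> 0 <= gap w.
Proof.
move=> cf cg; rewrite /gap /=.
move: (xpart w) (ypart w) (zpart w) (upart w) cf cg => x y z u cf cg u0.
rewrite grad2_LagrangianE /Lagrangian (dotC (_ + _)) dotDr.
have -> : dot (y - z) (\sum_(i < p) u 0 i *: grad (fun y => g x y 0 i) z) =
    \sum_(i < p) u 0 i * dot (grad (fun y => g x y 0 i) z) (y - z).
  rewrite /dot; under eq_bigr do rewrite summxE mulr_sumr.
  rewrite exchange_big; apply: eq_bigr => i _; rewrite mulr_sumr.
  by apply: eq_bigr => j _; rewrite !mxE; ring.
have tf := convex_ge_tangent y cf (differentiable_f2 x z).
have tg : dot u (g x z) +
    \sum_(i < p) u 0 i * dot (grad (fun y => g x y 0 i) z) (y - z) <=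
    dot u (g x y).
  rewrite -big_split/=; apply: ler_sum => i _; rewrite -mulrDr ler_wpM2l//.
  exact: (convex_ge_tangent y (cg i) (differentiable_g2 i x z)).
rewrite (dotC (y - z)); lra.
Qed.


Lemma differentiable_f_xy w :
  differentiable (fun w : point => f (xpart w) (ypart w)) w.
Proof.
rewrite (_ : (fun w => _) =
  fun w : point => joint f (row_mx (xpart w) (ypart w))).
  by apply: differentiable_at_xy; case: hf => -[].
by apply/funext => w'; rewrite jointE.
Qed.

Lemma differentiable_f_xz w :
  differentiable (fun w : point => f (xpart w) (zpart w)) w.
Proof.
rewrite (_ : (fun w => _) =
  fun w : point => joint f (row_mx (xpart w) (zpart w))).
  by apply: differentiable_at_xz; case: hf => -[].
by apply/funext => w'; rewrite jointE.
Qed.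

Lemma differentiable_g_xy w i :
  differentiable (fun w : point => g (xpart w) (ypart w) 0 i) w.
Proof.
rewrite (_ : (fun w => _) = fun w : point =>
  joint (fun x y => g x y 0 i) (row_mx (xpart w) (ypart w))).
  by apply: differentiable_at_xy; case: (hg i) => -[].
by apply/funext => w'; rewrite (jointE (fun x y => g x y 0 i)).
Qed.

Lemma differentiable_g_xz w i :
  differentiable (fun w : point => g (xpart w) (zpart w) 0 i) w.
Proof.
rewrite (_ : (fun w => _) = fun w : point =>
  joint (fun x y => g x y 0 i) (row_mx (xpart w) (zpart w))).
  by apply: differentiable_at_xz; case: (hg i) => -[].
by apply/funext => w'; rewrite (jointE (fun x y => g x y 0 i)).
Qed.

(** The gap regrouped so that each summand is a constraint function or a
    product with a constraint function as a factor. *)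
Lemma gapE : gap = fun w =>
  (f (xpart w) (ypart w) - f (xpart w) (zpart w)) +
  (- dot (upart w) (g (xpart w) (zpart w)) +
  (\sum_(i < p) upart w 0 i * g (xpart w) (ypart w) 0 i +
   \sum_(j < m) MWD_eq f g w 0 j * (zpart w - ypart w) 0 j)).
Proof.
apply/funext => w; rewrite /gap /Lagrangian /MWD_eq -/(dot _ _) -/(dot _ _).
rewrite -(opprB (ypart w)) dotNr; ring.
Qed.

Lemma differentiable_f_gap w :
  differentiable (fun w : point =>
    f (xpart w) (ypart w) - f (xpart w) (zpart w)) w.
Proof.
by apply: differentiableB; [exact: differentiable_f_xy
  |exact: differentiable_f_xz].
Qed.

Lemma differentiable_dot_ug w :
  differentiable (fun w : point => - dot (upart w) (g (xpart w) (zpart w))) w.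
Proof.
apply: differentiableN; apply: differentiable_sumf => i.
by apply: differentiableM; [exact: differentiable_upart_coord
  |exact: differentiable_g_xz].
Qed.

Lemma differentiable_ug_xy w i :
  differentiable (fun w : point =>
    upart w 0 i * g (xpart w) (ypart w) 0 i) w.
Proof.
by apply: differentiableM; [exact: differentiable_upart_coord
  |exact: differentiable_g_xy].
Qed.

Lemma differentiable_zy_coord w j :
  differentiable (fun w : point => (zpart w - ypart w) 0 j) w.
Proof.
apply: (differentiable_comp (f := fun w : point => zpart w - ypart w)
  (g := fun v => v 0 j)); last exact: differentiable_coord.
by apply: differentiableB; [exact: differentiable_zpart
  |exact: differentiable_ypart].
Qed.

Lemma differentiable_stationarity_zy w j :
  differentiable (fun w : point =>
    MWD_eq f g w 0 j * (zpart w - ypart w) 0 j) w.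
Proof.
by apply: differentiableM; [exact: differentiable_stationarity
  |exact: differentiable_zy_coord].
Qed.

Lemma differentiable_gap w : differentiable gap w.
Proof.
rewrite gapE; apply: differentiableD; first exact: differentiable_f_gap.
apply: differentiableD; first exact: differentiable_dot_ug.
apply: differentiableD; apply: differentiable_sumf => i.
  exact: differentiable_ug_xy.
exact: differentiable_stationarity_zy.
Qed.

(** In the product rule for grad_2 L times z - y, the half that differentiates
    z - y is killed by stationarity; in that for u times g (x, y), the half
    that differentiates u is a multiple of the gradient of the constraint
    - u <= 0, which costs a sign. *)
Lemma grad_gap w : MWD_eq f g w = 0 ->
  grad gap w =
  grad (fun w => f (xpart w) (ypart w) - f (xpart w) (zpart w)) w +
  (grad (fun w => - dot (upart w) (g (xpart w) (zpart w))) w +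
  (\sum_(i < p) (upart w 0 i *: grad (fun w => g (xpart w) (ypart w) 0 i) w +
     - g (xpart w) (ypart w) 0 i *: grad (fun w : point => (- upart w) 0 i) w) +
   \sum_(j < m) (zpart w - ypart w) 0 j *: grad (fun w => MWD_eq f g w 0 j) w)).
Proof.
move=> st.
have dug := differentiable_sumf (differentiable_ug_xy w).
have dst := differentiable_sumf (differentiable_stationarity_zy w).
rewrite gapE gradD; [|exact: differentiable_f_gap|]; last first.
  by apply: differentiableD; [exact: differentiable_dot_ug
    |exact: differentiableD].
rewrite [X in _ + X = _]gradD; last 2 first.
- exact: differentiable_dot_ug.
- exact: differentiableD.
rewrite [X in _ + (_ + X) = _]gradD// grad_sum => [|i]; last first.
  exact: differentiable_ug_xy.
rewrite grad_sum => [|j]; last exact: differentiable_stationarity_zy.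
congr (_ + (_ + (_ + _))); apply: eq_bigr => i _; rewrite gradM.
- rewrite (_ : (fun w => (- upart w) 0 i) = fun w : point => - upart w 0 i).
    rewrite gradN ?scalerN ?scaleNr ?opprK//.
    exact: differentiable_upart_coord.
  by apply/funext => w'; rewrite mxE.
- exact: differentiable_upart_coord.
- exact: differentiable_g_xy.
- by rewrite st mxE scale0r add0r.
- exact: differentiable_stationarity.
- exact: differentiable_zy_coord.
Qed.

End Gap.

(** * The violation of MFCQ *)

Theorem theorem4p20 (R : realType) (n m p q : nat)
    (f : 'rV[R]_n -> 'rV[R]_m -> R)
    (g : 'rV[R]_n -> 'rV[R]_m -> 'rV[R]_p)
    (G : 'rV[R]_n -> 'rV[R]_q)
    (X : set 'rV[R]_n)
    (hX : X = [set x | nonpos (G x)])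
    (hG : forall i : 'I_q, C1 (fun x => G x 0 i))
    (hf : C2 (joint f))
    (hg : forall i : 'I_p, C2 (joint (fun x y => g x y 0 i)))
    (hf_convex : forall x, X x -> convex_function setT (f x))
    (hg_convex : forall x, X x -> forall i : 'I_p,
      convex_function setT (fun y => g x y 0 i))
    (xbar : 'rV[R]_n) (ybar zbar : 'rV[R]_m) (ubar : 'rV[R]_p)
    (hfeas : feasible (MWD_ineq f g G) (MWD_eq f g)
      (MWD_point xbar ybar zbar ubar)) :
  ~ MFCQ (MWD_ineq f g G) (MWD_eq f g) (MWD_point xbar ybar zbar ubar).

Proof.
case: (hfeas) => hI hE.
have [Gx gy u0 fyz [ugz0 st0]] := (MWD_feasibleP _ _ _ _ _ _ _).1 hfeas.
set w := MWD_point _ _ _ _ in hI hE *.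
have xw : xpart w = xbar by rewrite /xpart row_mxKl.
have yw : ypart w = ybar by rewrite /ypart row_mxKr row_mxKl.
have zw : zpart w = zbar by rewrite /zpart !row_mxKr row_mxKl.
have uw : upart w = ubar by rewrite /upart !row_mxKr.
have Ew : gap f g w = f xbar ybar - f xbar zbar + dot ubar (g xbar ybar)
    - dot ubar (g xbar zbar).
  rewrite /gap xw yw zw uw st0 /Lagrangian.
  rewrite (_ : dot 0 _ = 0); last first.
    by rewrite /dot big1// => i _; rewrite mxE mul0r.
  ring.
have ugy_le0 i : ubar 0 i * g xbar ybar 0 i <= 0 by rewrite mulr_ge0_le0.
have E0 w' : nonpos (G (xpart w')) -> (forall i, 0 <= upart w' 0 i) ->
    0 <= gap f g w'.
  move=> Gx' u0'; have Xx : X (xpart w') by rewrite hX.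
  by apply: gap_ge0 => //; [exact: hf_convex|move=> i; exact: hg_convex].
have := E0 w; rewrite xw uw => /(_ Gx u0) Ew0.
have ugy_sum : dot ubar (g xbar ybar) <= 0 by apply: sumr_le0.
(* The three nonpositive summands in [Ew] add up to at least 0. *)
have ugyE i : ubar 0 i * g xbar ybar 0 i = 0.
  apply/eqP; rewrite eq_le ugy_le0/=.
  have : dot ubar (g xbar ybar) <= ubar 0 i * g xbar ybar 0 i.
    rewrite /dot (bigD1 i)//= gerDl; exact: sumr_le0.
  by apply: le_trans; rewrite Ew in Ew0; lra.
(* The constraints G (x) <= 0 and - u <= 0 under which the gap is minimal. *)
pose c (i : 'I_q + 'I_p) (w' : 'rV[R]_(n + (m + (m + p)))) : R :=
  match i with inl i => G (xpart w') 0 i | inr i => (- upart w') 0 i end.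
have dc i : differentiable (c i) w.
  case: i => i.
    apply: (differentiable_comp (f := @xpart R n m p) (g := fun x => G x 0 i)).
      exact: differentiable_xpart.
    by case: (hG i).
  apply: (differentiable_comp (f := fun w' => - @upart R n m p w')
    (g := fun u => u 0 i)); last exact: differentiable_coord.
  by apply: differentiableN; exact: differentiable_upart.
have cw i : c i w <= 0 by case: i => i /=; rewrite ?xw// uw mxE oppr_le0.
have [|mu [l [[mu0 l0] lpos lc st]]] :=
    fritz_john (differentiable_gap hf hg w) dc cw.
  move=> w' cw'; apply: le_trans (_ : 0 <= _); first by rewrite Ew; lra.
  apply: E0 => i; first exact: (cw' (inl i)).
  by have := cw' (inr i); rewrite /= mxE oppr_le0.
(* Fritz John multipliers plus mu times the coefficients of [grad gap]; those
   of the constraints - u <= 0 come from both sources. *)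
pose a : 'rV[R]_(q + (p + (p + (1 + 1)))) :=
  row_mx (\row_i l (inl i)) (row_mx (mu *: ubar)
  (row_mx (\row_i (l (inr i) - mu * g xbar ybar 0 i))
  (row_mx (const_mx mu) (const_mx mu)))).
have aP i : 0 <= a 0 i /\ a 0 i * MWD_ineq f g G w 0 i = 0.
  move: i; rewrite /MWD_ineq xw yw zw uw.
  do 4?[apply: (row_mx_rel (P := fun s t => 0 <= s /\ s * t = 0))];
    move=> i; rewrite !mxE.
  - by split=> //; have := lc (inl i); rewrite /= xw.
  - by split; [rewrite mulr_ge0|rewrite -mulrA ugyE mulr0].
  - split; first by rewrite subr_ge0 (le_trans _ (l0 _))// mulr_ge0_le0.
    have := lc (inr i); rewrite /= uw mxE mulrBl => ->.
    by rewrite mulrN -mulrA (mulrC (g _ _ _ _)) ugyE mulr0 oppr0 subrr.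
  - by split=> //; rewrite Ew in Ew0; rewrite (_ : _ - _ = 0) ?mulr0//; lra.
  - split=> //; rewrite Ew in Ew0.
    by rewrite (_ : dot _ _ = 0) ?oppr0 ?mulr0//; lra.
move=> /(_ a (mu *: (zbar - ybar))) [|||a0 _].
- rewrite /MWD_ineq !combine_row_mx !combine_const_mx -[RHS]st.
  rewrite (grad_gap hf hg hE) big_sumType/= xw yw zw uw big_split/=.
  under [X in X + _ + _]eq_bigr do rewrite mxE.
  under [X in _ + (X + _) + _]eq_bigr do rewrite mxE -scalerA.
  under [X in _ + (_ + (X + _)) + _]eq_bigr do
    rewrite mxE scalerBl -scalerA -scalerN -scaleNr.
  under [X in _ + _ + X = _]eq_bigr do rewrite mxE -scalerA.
  rewrite big_split/= -!scaler_sumr.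
  set S1 := \sum_(i < q) _; set S3 := \sum_(i < p) l _ *: _.
  have key (v1 v2 v3 v4 v5 v6 v7 : 'rV[R]_(n + (m + (m + p)))) :
    v1 + (mu *: v2 + (v3 + mu *: v4 + (mu *: v6 + mu *: v7))) + mu *: v5 =
    mu *: (v6 + (v7 + (v2 + v4 + v5))) + (v1 + v3).
    by apply/rowP => k; rewrite !mxE; ring.
  exact: key.
- by move=> i; case: (aP i).
- by move=> i; case: (aP i).
have /eq_row_mx[l1 /eq_row_mx[_ /eq_row_mx[l2 /eq_row_mx[/rowP/(_ 0) + _]]]] :
    a = row_mx 0 (row_mx 0 (row_mx 0 (row_mx 0 0))) by rewrite a0 !row_mx0.
rewrite !mxE => mu_eq0.
case: lpos => [|[[i|i]]]; first by rewrite mu_eq0 ltxx.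
  by move/rowP: l1 => /(_ i); rewrite !mxE => ->; rewrite ltxx.
by move/rowP: l2 => /(_ i); rewrite !mxE mu_eq0 mul0r subr0 => ->; rewrite ltxx.
Qed.
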